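(* Let $n$ be a non-negative integer. If $\{(s_k),(\sigma_k)\}$ and $\{(t_k),(\tau_k)\}$, $k=0,1,2,\ldots$, are binomial-transform pairs of the first kind, then \[ \sum_{k=1}^n(-1)^{n-k-1}\binom nk s_{k-1}t_{n-k}=\sum_{k=1}^n(-1)^k\binom nk\tau_{n-k}\sum_{j=1}^k\sigma_{j-1}. \]
   Context: Two sequences $(s_k)_{k\ge0}$ and $(\sigma_k)_{k\ge0}$ of complex numbers form a binomial-transform pair of the first kind if $\sigma_n=\sum_{k=0}^n(-1)^k\binom nk s_k$ for every non-negative integer $n$. *)

(* Defs.v *)
(* The complex numbers are R[i], over an arbitrary model R : realType of the
   reals. *)
From HB Require Import structures.
From mathcomp Require Import all_boot all_order all_algebra.
From mathcomp Require Import reals.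
From mathcomp Require Import complex.

Set Implicit Arguments.
Unset Strict Implicit.
Unset Printing Implicit Defensive.

Import GRing.Theory Num.Theory.

Local Open Scope ring_scope.

Definition binomial_transform_pair (R : realType) (s sigma : nat -> R[i]) :
    Prop :=
  forall n : nat,
    sigma n = \sum_(0 <= k < n.+1) (-1) ^+ k * 'C(n, k)%:R * s k.

(* Main.v *)
(* Umbrally, with s_i t_j in place of x^i y^j, the expansion of
   ((1 - y) - (1 - x))^n = (x - y)^n gives
   sum_k (-1)^k C(n,k) sigma_k tau_(n-k)
     = sum_k (-1)^(n-k) C(n,k) s_k t_(n-k).
   The theorem is this identity for the shifted sequence 0, s_0, s_1, ...,
   whose transform is minus the sequence of partial sums of sigma. *)
Require Import Defs.
From HB Require Import structures.
From mathcomp Require Import all_boot all_order all_algebra.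
From mathcomp Require Import reals.
From mathcomp Require Import complex.
From mathcomp Require Import ring.

Set Implicit Arguments.
Unset Strict Implicit.
Unset Printing Implicit Defensive.

Import GRing.Theory Num.Theory.

Local Open Scope ring_scope.

Section SignedConvolution.
Variable A : comNzRingType.
Implicit Types (s t sigma tau : nat -> A) (n : nat).

Lemma pascal_sum n (g : nat -> A) :
  \sum_(0 <= k < n.+2) 'C(n.+1, k)%:R * g k =
  \sum_(0 <= k < n.+1) 'C(n, k)%:R * (g k + g k.+1).
Proof.
under [RHS]eq_bigr do rewrite mulrDr.
rewrite big_split /= [LHS]big_nat_recl //.
under [X in _ + X = _]eq_bigr do rewrite binS natrD mulrDl.
rewrite big_split /= addrA; congr (_ + _).
by rewrite [RHS]big_nat_recl // big_nat_recr //= (bin_small (ltnSn n)) mul0r addr0 !bin0.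
Qed.

(** Umbrally [(y - x)^n], with [s i * t j] in place of [x^i y^j]. *)
Definition sconv s t n : A :=
  \sum_(0 <= k < n.+1) (-1) ^+ k * 'C(n, k)%:R * s k * t (n - k)%N.

Lemma sconv0 s t : sconv s t 0 = s 0%N * t 0%N.
Proof. by rewrite /sconv big_nat1 bin0 expr0 !mul1r. Qed.

(** Umbrally, [(y - x)^(n+1) = y (y - x)^n - x (y - x)^n]. *)
Lemma sconvS s t n :
  sconv s t n.+1 = sconv s (t \o succn) n - sconv (s \o succn) t n.
Proof.
rewrite /sconv.
under eq_bigr do rewrite -!mulrA mulrCA.
rewrite (pascal_sum n (fun k => (-1) ^+ k * (s k * t (n.+1 - k)%N))) -sumrB.
apply: eq_big_nat => k /andP[_ le_kn] /=.
by rewrite subSS subSn // exprS; ring.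
Qed.

Lemma sconvBl s s' t n :
  sconv (fun k => s k - s' k) t n = sconv s t n - sconv s' t n.
Proof. by rewrite /sconv -sumrB; apply: eq_bigr => k _; ring. Qed.

Lemma sconvBr s t t' n :
  sconv s (fun k => t k - t' k) n = sconv s t n - sconv s t' n.
Proof. by rewrite /sconv -sumrB; apply: eq_bigr => k _; ring. Qed.

(* The binomial transform of s is its convolution with the constant 1. *)
Lemma transform_succ s sigma :
    (forall n, sigma n = sconv s (fun=> 1) n) ->
  forall n, sigma n - sigma n.+1 = sconv (s \o succn) (fun=> 1) n.
Proof. by move=> hs n; rewrite !hs sconvS subKr. Qed.

Lemma sconv_transform s sigma t tau n :
    (forall m, sigma m = sconv s (fun=> 1) m) ->
    (forall m, tau m = sconv t (fun=> 1) m) ->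
  sconv t s n = sconv sigma tau n.
Proof.
(* All four sequences are generalized, since [sconvS] shifts [s] or [t], and a shift turns the
   transform into its differences. *)
elim: n => [|n IHn] in s sigma t tau * => hs ht.
  by rewrite !sconv0 hs ht !sconv0 !mulr1 mulrC.
rewrite !sconvS (IHn _ _ _ _ (transform_succ hs) ht).
rewrite (IHn _ _ _ _ hs (transform_succ ht)).
(* The two copies of [sconv sigma tau n] cancel. *)
by rewrite sconvBl sconvBr opprB addrC addrA subrK.
Qed.

Lemma sconv_rev s t n :
  sconv t s n =
  \sum_(0 <= k < n.+1) (-1) ^+ (n - k) * 'C(n, k)%:R * s k * t (n - k)%N.
Proof.
rewrite /sconv big_nat_rev; apply: eq_big_nat => k /andP[_ le_kn].
by rewrite add0n subSS subKn // bin_sub //; ring.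
Qed.

Definition delay s k : A := if k is k'.+1 then s k' else 0.

(** Shifting [delay s] gives back [s], so by [sconvS] its transform drops by [sigma n] from [n] to
    [n.+1]. *)
Lemma delay_transform s sigma :
    (forall n, sigma n = sconv s (fun=> 1) n) ->
  forall n, - \sum_(0 <= j < n) sigma j = sconv (delay s) (fun=> 1) n.
Proof.
move=> hs; elim=> [|n IHn]; first by rewrite sconv0 big_geq // oppr0 mul0r.
by rewrite sconvS big_nat_recr //= opprD IHn hs.
Qed.

End SignedConvolution.

(* The sign exponent n - k - 1 is an integer power, since it equals -1 at
   k = n; the subtraction in the index of t and tau is exact because k <= n. *)
Theorem theorem28 (R : realType) (n : nat) (s sigma t tau : nat -> R[i])
    (hs : binomial_transform_pair s sigma)
    (ht : binomial_transform_pair t tau) :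
  \sum_(1 <= k < n.+1)
     (-1 : R[i]) ^ (n%:Z - k%:Z - 1) * 'C(n, k)%:R * s (k - 1)%N * t (n - k)%N
  = \sum_(1 <= k < n.+1)
     (-1) ^+ k * 'C(n, k)%:R * tau (n - k)%N
       * \sum_(1 <= j < k.+1) sigma (j - 1)%N.
Proof.
have transformE (u v : nat -> R[i]) : binomial_transform_pair u v ->
    forall m, v m = sconv u (fun=> 1) m.
  by move=> huv m; rewrite huv; apply: eq_bigr => k _; rewrite mulr1.
have := sconv_transform n (delay_transform (transformE _ _ hs))
                          (transformE _ _ ht).
rewrite sconv_rev /sconv big_nat_recl // [X in _ = X]big_nat_recl //=.
(* Both terms at [k = 0] vanish. Negating both sides supplies the [- 1] in the sign exponent and
   cancels the minus before the partial sums. *)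
rewrite (@big_geq _ _ _ 0 0) // oppr0 !(mulr0, mul0r) !add0r => /(congr1 -%R) E.
rewrite !big_add1 /=; apply: etrans (etrans E _); rewrite -sumrN.
  apply: eq_big_nat => k /andP[_ lt_kn].
  rewrite subn1 /= -!mulNr; congr (_ * _ * _ * _).
  rewrite subzn // expfzDr ?oppr_eq0 ?oner_eq0 //.
  by rewrite exprN1 invrN1 mulrN1.
apply: eq_bigr => k _; rewrite mulrN mulNr opprK big_add1 /=.
by under [in RHS]eq_bigr do rewrite subn1 /=; rewrite mulrAC.
Qed.
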